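(* Let $(\mathfrak g,\nu,\alpha)$ be a Hom-Lie algebra over a field $\mathbb K$ of characteristic zero, with bracket $\nu(x\otimes y)=[x,y]$, and let $(M,\beta)$ be a $\mathfrak g$-module. With $\widetilde C^n(\mathfrak g,M)=C^n_\nu(\mathfrak g,M)\oplus C^n_\alpha(\mathfrak g,M)$ and the four maps $\partial_{\nu\nu},\partial_{\alpha\alpha},\partial_{\nu\alpha},\partial_{\alpha\nu}$ defined in the context, let $\partial:\widetilde C^n(\mathfrak g,M)\to\widetilde C^{n+1}(\mathfrak g,M)$ be given by $$\partial(\varphi,\psi)=\bigl(\partial_{\nu\nu}\varphi-\partial_{\alpha\nu}\psi,\ \partial_{\nu\alpha}\varphi-\partial_{\alpha\alpha}\psi\bigr).$$ Then $(\widetilde C^\bullet(\mathfrak g,M),\partial)$ is a cochain complex, i.e. $\partial\circ\partial=0$.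
   Context: A Hom-Lie algebra $(\mathfrak g,\nu,\alpha)$ is a $\mathbb K$-vector space $\mathfrak g$ with a linear map $\alpha:\mathfrak g\to\mathfrak g$ and a skew-symmetric bilinear bracket $[\cdot,\cdot]$ such that $[[x,y],\alpha(z)]+[[y,z],\alpha(x)]+[[z,x],\alpha(y)]=0$ and $[\alpha(x),\alpha(y)]=\alpha([x,y])$ for all $x,y,z\in\mathfrak g$. A $\mathfrak g$-module is a vector space $M$ with a linear map $\beta:M\to M$ and a bilinear action $\mathfrak g\times M\to M$, $(x,v)\mapsto x\cdot v$, such that $[x,y]\cdot\beta(v)=\alpha(x)\cdot(y\cdot v)-\alpha(y)\cdot(x\cdot v)$ and $\beta(x\cdot v)=\alpha(x)\cdot\beta(v)$. Set $C^n_\nu(\mathfrak g,M)=\mathrm{Hom}(\Lambda^n\mathfrak g,M)$ for $n\ge1$ and $C^n_\alpha(\mathfrak g,M)=\mathrm{Hom}(\Lambda^{n-1}\mathfrak g,M)$ for $n\ge2$; all other spaces are $0$ (in particular $\mathrm{Hom}(\Lambda^0\mathfrak g,M)$ is set to be $\{0\}$). For $\varphi\in C^n_\nu$, $\psi\in C^n_\alpha$ and $x_1,\dots,x_{n+1}\in\mathfrak g$, where a hat denotes omission, define $$(\partial_{\nu\nu}\varphi)(x_1,\dots,x_{n+1})=\sum_{i=1}^{n+1}(-1)^{i+1}\alpha^{n-1}(x_i)\cdot\varphi(x_1,\dots,\widehat{x_i},\dots,x_{n+1})-\sum_{i<j}(-1)^{i+j-1}\varphi([x_i,x_j],\alpha(x_1),\dots,\widehat{x_i},\dots,\widehat{x_j},\dots,\alpha(x_{n+1})),$$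 $$(\partial_{\alpha\alpha}\psi)(x_1,\dots,x_n)=\sum_{i=1}^{n}(-1)^{i+1}\alpha^{n-1}(x_i)\cdot\psi(x_1,\dots,\widehat{x_i},\dots,x_n)-\sum_{i<j}(-1)^{i+j-1}\psi([x_i,x_j],\alpha(x_1),\dots,\widehat{x_i},\dots,\widehat{x_j},\dots,\alpha(x_n)),$$ $$(\partial_{\nu\alpha}\varphi)(x_1,\dots,x_n)=\beta(\varphi(x_1,\dots,x_n))-\varphi(\alpha(x_1),\dots,\alpha(x_n)),$$ $$(\partial_{\alpha\nu}\psi)(x_1,\dots,x_{n+1})=\sum_{i<j}(-1)^{i+j-1}[\alpha^{n-2}(x_i),\alpha^{n-2}(x_j)]\cdot\psi(x_1,\dots,\widehat{x_i},\dots,\widehat{x_j},\dots,x_{n+1}).$$ Thus $\partial_{\nu\nu}:C^n_\nu\to C^{n+1}_\nu$, $\partial_{\alpha\alpha}:C^n_\alpha\to C^{n+1}_\alpha$, $\partial_{\nu\alpha}:C^n_\nu\to C^{n+1}_\alpha$, $\partial_{\alpha\nu}:C^n_\alpha\to C^{n+1}_\nu$. *)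

(* Defs.v *)
From mathcomp Require Import all_boot all_algebra.
From mathcomp Require Import boolp classical_sets functions.
Set Implicit Arguments.
Unset Strict Implicit.
Unset Printing Implicit Defensive.
Import GRing.Theory.
Local Open Scope ring_scope.

Record homLieAlgebra (K : fieldType) := HomLieAlgebra {
  hl_space :> lmodType K;
  hl_bracket : {bilinear hl_space -> hl_space -> hl_space};
  hl_twist : {linear hl_space -> hl_space};
  hl_skew : forall x y, hl_bracket x y = - hl_bracket y x;
  hl_jacobi : forall x y z,
    hl_bracket (hl_bracket x y) (hl_twist z)
    + hl_bracket (hl_bracket y z) (hl_twist x)
    + hl_bracket (hl_bracket z x) (hl_twist y) = 0;
  hl_mult : forall x y,
    hl_bracket (hl_twist x) (hl_twist y) = hl_twist (hl_bracket x y)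
}.

Record homLieModule (K : fieldType) (g : homLieAlgebra K) := HomLieModule {
  hm_space :> lmodType K;
  hm_twist : {linear hm_space -> hm_space};
  hm_act : {bilinear g -> hm_space -> hm_space};
  hm_bracket : forall x y v,
    hm_act (hl_bracket g x y) (hm_twist v)
    = hm_act (hl_twist g x) (hm_act y v) - hm_act (hl_twist g y) (hm_act x v);
  hm_equiv : forall x v,
    hm_twist (hm_act x v) = hm_act (hl_twist g x) (hm_twist v)
}.

Definition multilinear (K : fieldType) (V W : lmodType K) (n : nat)
    (f : ('I_n -> V) -> W) : Prop :=
  forall (i : 'I_n) (x : 'I_n -> V), linear (fun u => f [eta x with i |-> u]).

Definition alternating (K : fieldType) (V W : lmodType K) (n : nat)
    (f : ('I_n -> V) -> W) : Prop :=
  forall (x : 'I_n -> V) (i j : 'I_n), i != j -> x i = x j -> f x = 0.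

(* Hom(Lambda^n V, W), through the universal property of the exterior power,
   with the convention Hom(Lambda^0 V, W) = {0}. *)
Definition hom_ext (K : fieldType) (V W : lmodType K) (n : nat)
    (f : ('I_n -> V) -> W) : Prop :=
  [/\ multilinear f, alternating f & n = 0%N -> f = 0].

(* The increasing enumeration of the positions different from i and j, for
   i < j; the default value i of insubd is then never used (val_skip2). *)
Definition skip2 (k : nat) (i j : 'I_k) (m : 'I_k.-1.-1) : 'I_k :=
  insubd i (bump j (bump i m)).

Lemma val_skip2 (k : nat) (i j : 'I_k) (m : 'I_k.-1.-1) :
  (i < j)%N -> val (skip2 i j m) = bump j (bump i m).
Proof.
move=> ij; rewrite val_insubd; case: ifP => // /negP[]; rewrite /bump.
case: k i j m ij => [[]//|[|k]] i j [m /= mk] ij; first by [].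
exact: leq_ltn_trans (leq_add (leq_b1 _) (leq_add (leq_b1 _) (leqnn m))) _.
Qed.

(* The argument list (a, y_1, ..., y_(n-1)). *)
Definition cons_args (T : Type) (n : nat) (a : T) :
    ('I_n.-1 -> T) -> 'I_n -> T :=
  if n is m.+1 then fun y k => oapp y a (unlift ord0 k) else fun _ _ => a.

Section Coboundary.
Variables (K : fieldType) (g : homLieAlgebra K) (M : homLieModule g).
Local Notation br := (hl_bracket g).
Local Notation alpha := (hl_twist g).
Local Notation beta := (hm_twist M).
Local Notation act := (hm_act M).

(* The common shape of the two diagonal maps, for a cochain f with k - 1
   arguments evaluated on k arguments. Positions are counted from 0, so that
   the signs (-1)^(i+1) and (-1)^(i+j-1) become (-1)^i and (-1)^(i+j+1). *)
Definition diag_cobound (k p : nat) (f : ('I_k.-1 -> g) -> M)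
    (x : 'I_k -> g) : M :=
  \sum_(i < k) (-1) ^+ i *:
     act (iter p alpha (x i)) (f (fun m => x (lift i m)))
  - \sum_(i < k) \sum_(j < k | (i < j)%N) (-1) ^+ (i + j + 1)%N *:
     f (cons_args (br (x i) (x j)) (fun m => alpha (x (skip2 i j m)))).

(* In the four maps, n is the degree of the source: an element of C^n_nu has n
   arguments and an element of C^n_alpha has n - 1. *)
Definition d_nunu (n : nat) (f : ('I_n -> g) -> M) : ('I_n.+1 -> g) -> M :=
  diag_cobound (k := n.+1) n.-1 f.

Definition d_alal (n : nat) (f : ('I_n.-1 -> g) -> M) : ('I_n -> g) -> M :=
  diag_cobound (k := n) n.-1 f.

Definition d_nual (n : nat) (f : ('I_n -> g) -> M) : ('I_n -> g) -> M :=
  fun x => beta (f x) - f (fun m => alpha (x m)).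

Definition d_alnu (n : nat) (f : ('I_n.-1 -> g) -> M) : ('I_n.+1 -> g) -> M :=
  fun x => \sum_(i < n.+1) \sum_(j < n.+1 | (i < j)%N) (-1) ^+ (i + j + 1)%N *:
    act (br (iter (n - 2)%N alpha (x i)) (iter (n - 2)%N alpha (x j)))
        (f (fun m => x (skip2 i j m))).

Definition precochain (n : nat) : lmodType K :=
  ((('I_n -> g) -> M) * (('I_n.-1 -> g) -> M))%type.

(* C^n_nu (+) C^n_alpha. The convention on Hom(Lambda^0 g, M) in hom_ext makes
   C^0_nu, C^0_alpha and C^1_alpha zero. *)
Definition cochain (n : nat) (c : precochain n) : Prop :=
  hom_ext c.1 /\ hom_ext c.2.

Definition cobound (n : nat) (c : precochain n) : precochain n.+1 :=
  (d_nunu c.1 - d_alnu c.2, d_nual c.1 - d_alal c.2).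

End Coboundary.

(* The subspaces C n of A n form a cochain complex under the maps d n. *)
Definition is_cochain_complex (K : fieldType) (A : nat -> lmodType K)
    (C : forall n, A n -> Prop) (d : forall n, A n -> A n.+1) : Prop :=
  [/\ forall n, C n 0 /\ (forall a u v, C n u -> C n v -> C n (a *: u + v)),
      forall n c, C n c -> C n.+1 (d n c),
      forall n, linear (d n)
    & forall n c, C n c -> d n.+1 (d n c) = 0].

(* Main.v *)
(* Every map in the complex is a combination of alternating sums
   altsum F x = sum_i (-1)^i F(x_i; x without x_i): the sums over pairs i < j are
   halves of iterated alternating sums. Three facts about them suffice: evaluating
   an alternating sum at a list (a, y) splits off the term of a and leaves minus
   the alternating sum over y; exchanging two nested sums changes the sign; hence
   a triple sum whose summand has zero cyclic sum vanishes in characteristic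
   other than 3. In each component of d o d, expanding the cochains at
   ([x_i,x_j], alpha x_1, ...) leaves terms that cancel through the module
   axiom, the Hom-Jacobi identity, or the symmetry exchanging two disjoint pairs
   of arguments. *)
Require Import Defs.
From mathcomp Require Import all_boot all_algebra all_fingroup.
From mathcomp Require Import boolp functions zify.
Set Implicit Arguments.
Unset Strict Implicit.
Unset Printing Implicit Defensive.
Import GRing.Theory.
Local Open Scope ring_scope.

(** * Argument lists with a prepended entry *)

Lemma cons_args_lift (T : Type) k (a : T) (y : 'I_k -> T) (m : 'I_k) :
  cons_args (n := k.+1) a y (lift ord0 m) = y m.
Proof. by rewrite /cons_args liftK. Qed.

Lemma comp_cons_args (T U : Type) k (h : T -> U) (a : T) (y : 'I_k.-1 -> T) :
  (fun m => h (cons_args (n := k) a y m)) = cons_args (h a) (fun m => h (y m)).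
Proof.
apply/funext; case: k y => [|k] y m //=.
by case: (unlift _ _).
Qed.

Lemma cons_args_lift_lift (T : Type) k (a : T) (y : 'I_k -> T) (i : 'I_k) :
  (fun m => cons_args (n := k.+1) a y (lift (lift ord0 i) m))
  = cons_args (n := k) a (fun m => y (lift i m)).
Proof.
apply/funext; case: k y i => [|k] y i m; first by case: i.
case: (unliftP ord0 m) => [j|] -> /=; last first.
  have -> : lift (lift ord0 i) ord0 = ord0 by apply/val_inj.
  by rewrite !unlift_none.
have -> : lift (lift ord0 i) (lift ord0 j) = lift ord0 (lift i j).
  by apply/val_inj; rewrite /= /bump /=; lia.
by rewrite !liftK.
Qed.

(** * Alternating sums over one or two removed arguments *)

Section AltSum.
Variables (K : fieldType) (V : Type).
Implicit Types W : lmodType K.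

(** [F] receives the remaining arguments as a function, so it may itself be an alternating sum of
    them, and multiple sums are plain nestings of [altsum]. *)
Definition altsum W k (F : V -> ('I_k.-1 -> V) -> W) (x : 'I_k -> V) : W :=
  \sum_(i < k) (-1) ^+ i *: F (x i) (fun m => x (lift i m)).

Lemma eq_altsum W k (F G : V -> ('I_k.-1 -> V) -> W) x :
  (forall a r, F a r = G a r) -> altsum F x = altsum G x.
Proof. by move=> FG; apply: eq_bigr => i _; rewrite FG. Qed.

Lemma altsum_comp W k (h : V -> V) (F : V -> ('I_k.-1 -> V) -> W) x :
  altsum F (fun m => h (x m))
  = altsum (fun a r => F (h a) (fun m => h (r m))) x.
Proof. by []. Qed.

Lemma linear_altsum W W' (h : {linear W -> W'}) k
    (F : V -> ('I_k.-1 -> V) -> W) x :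
  h (altsum F x) = altsum (fun a r => h (F a r)) x.
Proof. by rewrite linear_sum; apply: eq_bigr => i _; rewrite linearZ. Qed.

Lemma altsumD W k (F G : V -> ('I_k.-1 -> V) -> W) x :
  altsum (fun a r => F a r + G a r) x = altsum F x + altsum G x.
Proof. by rewrite -big_split; apply: eq_bigr => i _; rewrite scalerDr. Qed.

Lemma altsumZ W c k (F : V -> ('I_k.-1 -> V) -> W) x :
  altsum (fun a r => c *: F a r) x = c *: altsum F x.
Proof. by rewrite (linear_altsum ( *:%R c)). Qed.

Lemma altsumN W k (F : V -> ('I_k.-1 -> V) -> W) x :
  altsum (fun a r => - F a r) x = - altsum F x.
Proof. by rewrite (linear_altsum (-%R)). Qed.

Lemma altsumB W k (F G : V -> ('I_k.-1 -> V) -> W) x :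
  altsum (fun a r => F a r - G a r) x = altsum F x - altsum G x.
Proof. by rewrite altsumD altsumN. Qed.

(** Removing a tail entry keeps the head [a], and that entry sits one position later than in [y];
    hence the minus sign. *)
Lemma altsum_cons W k (F : V -> ('I_k -> V) -> W) a (y : 'I_k -> V) :
  altsum (k := k.+1) F (cons_args (n := k.+1) a y)
  = F a y - altsum (fun b r => F b (cons_args (n := k) a r)) y.
Proof.
rewrite /altsum big_ord_recl expr0 scale1r; congr (F _ _ + _).
- by rewrite /= unlift_none.
- by apply/funext => m; rewrite cons_args_lift.
- rewrite -sumrN; apply: eq_bigr => i _.
  rewrite cons_args_lift lift0 exprS mulN1r scaleNr; congr (- (_ *: F _ _)).
  exact: cons_args_lift_lift.
Qed.

(** The nested sum runs over ordered pairs of distinct positions. A removal shifts the later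
    positions down by one, so the two orders of removing a pair carry opposite signs. *)
Lemma altsum2_pairs W k (G : V -> V -> ('I_k.-1.-1 -> V) -> W) x :
  altsum (fun a => altsum (G a)) x
  = \sum_(i < k) \sum_(j < k | (i < j)%N) (-1) ^+ (i + j + 1)%N *:
      (G (x i) (x j) (fun m => x (skip2 i j m))
       - G (x j) (x i) (fun m => x (skip2 i j m))).
Proof.
case: k G x => [|k] G x; first by rewrite /altsum !big_ord0.
(* [H i j] is the term that removes [i] first. For i < j the position [j] has then become j - 1; the
   sign is written with exponent i + j + 1. *)
pose H (i j : 'I_k.+1) := if (i < j)%N
  then (-1) ^+ (i + j + 1) *: G (x i) (x j) (fun m => x (skip2 i j m))
  else (-1) ^+ (i + j) *: G (x i) (x j) (fun m => x (skip2 j i m)).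
transitivity (\sum_(i < k.+1) \sum_(j < k.+1 | j != i) H i j).
  apply: eq_bigr => i _.
  rewrite (reindex_omap (lift i) (unlift i)) /=; last first.
    by move=> j; case: unliftP => [m|] ->; rewrite ?eqxx.
  rewrite /altsum scaler_sumr.
  apply: eq_big => [j|j _]; first by rewrite liftK eqxx eq_sym neq_lift.
  rewrite scalerA -exprD /H; case: ifPn => ij.
    congr (_ *: G _ _ _).
      have -> : lift i j = j.+1 :> nat by move: ij; rewrite /= /bump; lia.
      by rewrite addn1 addnS !exprS !mulN1r opprK.
    apply/funext => m; congr x; apply/val_inj; rewrite /= val_skip2 //=.
    by move: ij; rewrite /= /bump; lia.
  have ji : (lift i j < i)%N by move: ij; rewrite /= /bump; lia.
  congr (_ *: G _ _ _); first by congr (_ ^+ _); move: ij; rewrite /= /bump; lia.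
  apply/funext => m; congr x; apply/val_inj; rewrite /= val_skip2 //=.
  by move: ij; rewrite /= /bump; lia.
transitivity (\sum_(i < k.+1) \sum_(j < k.+1 | (i < j)%N) (H i j + H j i)).
  under [RHS]eq_bigr do rewrite big_split.
  rewrite big_split /= [X in _ = _ + X](exchange_big_dep predT) //= -big_split /=.
  apply: eq_bigr => i _; rewrite (bigID (fun j : 'I_k.+1 => (i < j)%N)) /=.
  congr (_ + _); apply: eq_bigl => j; rewrite -val_eqE /=; lia.
apply: eq_bigr => i _; apply: eq_bigr => j ij.
rewrite /H ij ltnNge ltnW //= scalerBr; congr (_ + _).
by rewrite addn1 exprS mulN1r addnC scaleNr opprK.
Qed.

Lemma altsum2_swap W k (G : V -> V -> ('I_k.-1.-1 -> V) -> W) x :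
  altsum (fun a => altsum (G a)) x
  = - altsum (fun a => altsum (fun b => G b a)) x.
Proof.
rewrite !altsum2_pairs -sumrN; apply: eq_bigr => i _.
rewrite -sumrN; apply: eq_bigr => j _.
by rewrite -scalerN opprB.
Qed.

(** For skew [G] both orders of removal contribute equally. This turns the sums over i < j in the
    coboundary maps into nested sums. *)
Lemma altsum2_skew W k (G : V -> V -> ('I_k.-1.-1 -> V) -> W) x :
  (2 : K) != 0 -> (forall a b r, G a b r = - G b a r) ->
  \sum_(i < k) \sum_(j < k | (i < j)%N) (-1) ^+ (i + j + 1)%N *:
      G (x i) (x j) (fun m => x (skip2 i j m))
  = 2^-1 *: altsum (fun a => altsum (G a)) x.
Proof.
move=> K2 skew; rewrite altsum2_pairs scaler_sumr; apply: eq_bigr => i _.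
rewrite scaler_sumr; apply: eq_bigr => j _.
rewrite [G (x j) (x i) _]skew opprK -mulr2n -scaler_nat !scalerA.
by rewrite mulrAC mulVf ?mul1r.
Qed.

End AltSum.

Section Alternating.
Variables (K : fieldType) (V W : lmodType K).

(** Polarization: as a function [P] of the entries at [i] and [j], [f] is biadditive and vanishes on
    the diagonal, in particular at the sum of the two entries. *)
Lemma alternating_tperm n (f : ('I_n -> V) -> W) x i j :
  multilinear f -> alternating f -> i != j ->
  f (fun m => x (tperm i j m)) = - f x.
Proof.
move=> mf af ij; pose P u v := f [eta [eta x with j |-> v] with i |-> u].
have PDl u u' v : P (u + u') v = P u v + P u' v.
  by have := mf i [eta x with j |-> v] 1 u u'; rewrite !scale1r.
have Pji u v : P u v = f [eta [eta x with i |-> u] with j |-> v].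
  congr f; apply/funext => m /=; case: (m =P i) => // ->.
  by rewrite (negPf ij).
have PDr u v v' : P u (v + v') = P u v + P u v'.
  by rewrite !Pji; have := mf j [eta x with i |-> u] 1 v v'; rewrite !scale1r.
have P0 u : P u u = 0.
  by apply: (af _ i j) => //=; rewrite eqxx eq_sym (negPf ij) eqxx.
have := P0 (x i + x j); rewrite PDl !PDr !P0 add0r addr0 => /eqP.
rewrite addrC addr_eq0 => /eqP Pswap.
transitivity (P (x j) (x i)).
  by congr f; apply/funext => m /=; case: tpermP => [->|->|/eqP/negPf-> /eqP/negPf->];
    rewrite ?eqxx // eq_sym (negPf ij).
rewrite Pswap; congr (- f _); apply/funext => m /=.
by case: eqP => [->|] //; case: eqP => [->|].
Qed.

Lemma alternating_perm n (f : ('I_n -> V) -> W) x (s : 'S_n) :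
  multilinear f -> alternating f ->
  f (fun m => x (s m)) = (-1) ^+ s *: f x.
Proof.
move=> mf af; have [ts -> dts] := prod_tpermP s.
elim: ts dts x => [_ x|[i j] ts IH /= /andP[ij dts] x].
  by rewrite big_nil odd_perm1 scale1r; congr f; apply/funext => m; rewrite perm1.
rewrite big_cons odd_mul_tperm ij signr_addb -scalerA -IH // scaleN1r.
rewrite -(alternating_tperm _ mf af ij).
by congr f; apply/funext => m; rewrite permM.
Qed.

Lemma alternating_cons n (f : ('I_n.+2 -> V) -> W) a b (y : 'I_n -> V) :
  multilinear f -> alternating f ->
  f (cons_args (n := n.+2) a (cons_args (n := n.+1) b y))
  = - f (cons_args (n := n.+2) b (cons_args (n := n.+1) a y)).
Proof.
move=> mf af; pose i1 : 'I_n.+2 := lift ord0 ord0.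
rewrite -(@alternating_tperm _ f _ ord0 i1) //; congr f.
apply/funext => m; case: tpermP => [->|->|].
- by rewrite cons_args_lift /cons_args !unlift_none.
- by rewrite cons_args_lift /cons_args !unlift_none.
case: (unliftP ord0 m) => [j|] -> // _; rewrite !cons_args_lift.
by case: (unliftP ord0 j) => [l|] -> // _; rewrite !cons_args_lift.
Qed.

(** In the term removing [l], the varied argument is the first slot of [F] if l = i, and an entry of
    the remaining list otherwise. *)
Lemma multilinear_altsum k (F : V -> ('I_k.-1 -> V) -> W) :
  (forall r, linear (F^~ r)) -> (forall a, multilinear (F a)) ->
  multilinear (altsum F).
Proof.
move=> lF mF i x c u v; rewrite /altsum scaler_sumr -big_split /=.
apply: eq_bigr => l _; rewrite scalerA mulrC -scalerA -scalerDr; congr (_ *: _).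
have [->|il] := eqVneq l i.
  have upd w : (fun m => if lift i m == i then w else x (lift i m)) =
    fun m => x (lift i m).
    by apply/funext => m; rewrite eq_sym (negPf (neq_lift _ _)).
  by rewrite !upd lF.
have [m0 ->] : exists m0, i = lift l m0.
  by case: (unliftP l i) il => [m0 ->|->]; [exists m0|rewrite eqxx].
have upd w : (fun m => if lift l m == lift l m0 then w else x (lift l m)) =
    [eta (fun m => x (lift l m)) with m0 |-> w].
  by apply/funext => m; rewrite /= (inj_eq (@lift_inj _ _)).
by rewrite !upd mF.
Qed.

(** Terms removing a position other than [i] and [j] vanish, since both equal entries remain. The
    lists left by removing [i] or [j] differ by a permutation whose sign makes these two terms
    cancel. *)
Lemma alternating_altsum k (F : V -> ('I_k.-1 -> V) -> W) :
  (forall a, multilinear (F a)) -> (forall a, alternating (F a)) ->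
  alternating (altsum F).
Proof.
move=> mF aF x i j ij xij.
case: k F mF aF x i j ij xij => [|k] F mF aF x i j ij xij; first by case: i ij xij.
rewrite /altsum (bigD1 i) //= (bigD1 j) 1?eq_sym //= big1 ?addr0; last first.
  move=> l /andP[li lj].
  case: (unliftP l i) xij li ij => [i' ->|->]; rewrite ?eqxx //.
  case: (unliftP l j) lj => [j' ->|->]; rewrite ?eqxx // => _ xij _ ij.
  by rewrite (aF _ _ i' j') ?scaler0 // -(inj_eq (@lift_inj _ l)).
(* [s] is the transposition with [j] deleted from its source and [i] from its target. *)
have [s sE] : exists s : 'S_k, tperm i j = lift_perm j i s.
  pose g (m : 'I_k) : 'I_k := odflt m (unlift i (tperm i j (lift j m))).
  have gE m : lift i (g m) = tperm i j (lift j m).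
    rewrite /g; case: unliftP => [m' ->|] //= e.
    have /eqP := congr1 (tperm i j) e; rewrite tpermK tpermL eq_sym.
    by rewrite (negPf (neq_lift _ _)).
  have ginj : injective g.
    by move=> m m' e; apply/(@lift_inj _ j)/(@perm_inj _ (tperm i j)); rewrite -!gE e.
  exists (perm ginj); apply/permP => m; case: (unliftP j m) => [m'|] ->.
    by rewrite lift_perm_lift (permE ginj) gE.
  by rewrite lift_perm_id tpermR.
have -> : (fun m => x (lift j m)) = (fun m => x (lift i (s m))).
  apply/funext => m; rewrite -(lift_perm_lift j) -sE.
  by case: tpermP => [->|->|] //.
rewrite (alternating_perm (fun m => x (lift i m))) // xij scalerA.
(* Oddness of the transposition says that i + j plus the parity of [s] is odd, so the two
   coefficients are opposite. *)
have : odd_perm (tperm i j) = true by rewrite odd_tperm ij.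
rewrite sE odd_lift_perm => os.
rewrite -scalerDl [X in X *: _](_ : _ = 0) ?scale0r //.
rewrite -[(-1) ^+ i]signr_odd -[(-1) ^+ j]signr_odd -signr_addb.
by case: (odd i) (odd j) (odd_perm s) os => [] [] [] //= _;
  rewrite ?expr0 ?expr1 ?subrr ?addNr.
Qed.

End Alternating.

(** * Symmetries of iterated alternating sums in characteristic zero *)

Section IteratedAltSum.
Variables (K : fieldType) (V : Type) (W : lmodType K).
Hypothesis (charK0 : [pchar K] =i pred0).

Lemma pchar0_neq0 n : n.+1%:R != 0 :> K.
Proof. by rewrite (pcharf0P K).1. Qed.

Lemma altsum_eq0 k (F : V -> ('I_k.-1 -> V) -> W) x :
  (forall a r, F a r = 0) -> altsum F x = 0.
Proof. by move=> F0; apply: big1 => i _; rewrite F0 scaler0. Qed.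

(** Antisymmetrising the summand creates the difference of two iterated actions that appears in the
    module axiom. *)
Lemma altsum2_half k (G : V -> V -> ('I_k.-1.-1 -> V) -> W) x :
  altsum (fun a => altsum (G a)) x
  = 2^-1 *: altsum (fun a => altsum (fun b r => G a b r - G b a r)) x.
Proof.
under [X in _ = _ *: X]eq_altsum do rewrite altsumB.
rewrite altsumB [X in _ - X](altsum2_swap (fun a b => G b a)) opprK.
by rewrite -mulr2n -scaler_nat scalerA mulVf ?scale1r // pchar0_neq0.
Qed.

(** The entry [c] is removed first, second, or not at all. Skewness makes the first two cases equal;
    in the third the two minus signs from passing the head cancel. *)
Lemma altsum2_cons k (G : V -> V -> ('I_k.-1 -> V) -> W) c (y : 'I_k -> V) :
  (forall a b r, G a b r = - G b a r) ->
  altsum (k := k.+1) (fun a => altsum (G a)) (cons_args (n := k.+1) c y)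
  = 2 *: altsum (G c) y
    + altsum (fun a => altsum (fun b r => G a b (cons_args (n := k.-1) c r))) y.
Proof.
case: k G y => [|k] G y skew.
  by rewrite altsum_cons /altsum !big_ord0 subr0 addr0 scaler0.
rewrite altsum_cons.
under [X in _ - X]eq_altsum do rewrite altsum_cons.
rewrite altsumB opprB [X in _ + (_ - X)](eq_altsum (G := fun b r => - G c b r)) //.
by rewrite altsumN opprK addrCA addrC -mulr2n scaler_nat.
Qed.

(** A 3-cycle is a product of two transpositions, each changing the sign. *)
Lemma altsum3_cycle k (G : V -> V -> V -> ('I_k.-1.-1.-1 -> V) -> W) x :
  altsum (fun a => altsum (fun b => altsum (G a b))) x
  = altsum (fun a => altsum (fun b => altsum (fun c => G b c a))) x.
Proof.
under eq_altsum do rewrite altsum2_swap.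
by rewrite altsumN (altsum2_swap (fun a b => altsum (fun c => G a c b))) opprK.
Qed.

Lemma altsum3_jacobi k (G : V -> V -> V -> ('I_k.-1.-1.-1 -> V) -> W) x :
  (forall a b c r, G a b c r + G b c a r + G c a b r = 0) ->
  altsum (fun a => altsum (fun b => altsum (G a b))) x = 0.
Proof.
move=> jac; set s := LHS; apply/eqP.
have : s *+ 3 = 0.
  (* The second copy of [s] is rotated once and the third twice, so the three summands form a cyclic
     sum. *)
  rewrite mulrSr mulr2n {2 3}/s (altsum3_cycle G).
  rewrite {2}(altsum3_cycle (fun a b c => G b c a)).
  rewrite -!altsumD; apply: altsum_eq0 => a r.
  rewrite -!altsumD; apply: altsum_eq0 => b {}r.
  by rewrite -!altsumD; apply: altsum_eq0 => c {}r; apply: jac.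
by move/eqP; rewrite -scaler_nat scaler_eq0 (negPf (pchar0_neq0 2)).
Qed.

(** Exchanging the two pairs is a product of two 3-cycles, one on the outer three sums and one on
    the inner three. *)
Lemma altsum4_swap k (G : V -> V -> V -> V -> ('I_k.-1.-1.-1.-1 -> V) -> W) x :
  altsum (fun a => altsum (fun b => altsum (fun c => altsum (G a b c)))) x
  = altsum (fun a => altsum (fun b => altsum (fun c => altsum (fun d =>
      G c d a b)))) x.
Proof.
rewrite (altsum3_cycle (fun a b c => altsum (G a b c))).
by apply: eq_altsum => a r; rewrite (altsum3_cycle (fun b c d => G b c a d)).
Qed.

End IteratedAltSum.

(** * Closure properties of Hom(Lambda^n V, W) *)

Section Exterior.
Variables (K : fieldType) (V W : lmodType K).

Lemma linear_opp (h : V -> W) u : linear h -> h (- u) = - h u.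
Proof.
move=> /zmod_morphism_linear hB; rewrite -[- u]sub0r hB.
by rewrite -{1}(subrr (0 : V)) hB subrr sub0r.
Qed.

Lemma hom_ext0 n : hom_ext (0 : ('I_n -> V) -> W).
Proof. by split=> // i x a u v; rewrite scaler0 addr0. Qed.

Lemma hom_extP n a (f h : ('I_n -> V) -> W) :
  hom_ext f -> hom_ext h -> hom_ext (a *: f + h).
Proof.
move=> [mf af f0] [mh ah h0]; split => [i x b u v|x i j ij xij|n0].
- rewrite !addrfctE !scalrfctE /= (mf i x) (mh i x) !scalerDr addrACA.
  by rewrite !scalerA mulrC.
- by rewrite addrfctE scalrfctE /= (af _ _ _ ij) // (ah _ _ _ ij) // scaler0 addr0.
- by rewrite f0 // h0 // scaler0 addr0.
Qed.

Lemma hom_extB n (f h : ('I_n -> V) -> W) :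
  hom_ext f -> hom_ext h -> hom_ext (f - h).
Proof. by move=> ef eh; rewrite addrC -scaleN1r; apply: hom_extP. Qed.

Lemma hom_extZ n a (f : ('I_n -> V) -> W) : hom_ext f -> hom_ext (a *: f).
Proof. by move=> ef; rewrite -[_ *: _]addr0; apply: hom_extP (hom_ext0 _). Qed.

Lemma hom_ext_postcomp n (h : {linear W -> W}) (f : ('I_n -> V) -> W) :
  hom_ext f -> hom_ext (fun x => h (f x)).
Proof.
move=> [mf af f0]; split => [i x b u v|x i j ij xij|n0].
- by rewrite (mf i x) linearP.
- by rewrite (af _ _ _ ij) // raddf0.
- by apply/funext => x; rewrite f0 //= raddf0.
Qed.

Lemma multilinear_precomp n (h : {linear V -> V}) (f : ('I_n -> V) -> W) :
  multilinear f -> multilinear (fun x => f (fun m => h (x m))).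
Proof.
move=> mf i x b u v; have upd w : (fun m => h ([eta x with i |-> w] m)) =
    [eta (fun m => h (x m)) with i |-> h w].
  by apply/funext => m /=; case: eqP.
by rewrite !upd linearP mf.
Qed.

Lemma alternating_precomp n (h : V -> V) (f : ('I_n -> V) -> W) :
  alternating f -> alternating (fun x => f (fun m => h (x m))).
Proof. by move=> af x i j ij xij; apply: af ij _; rewrite xij. Qed.

Lemma hom_ext_precomp n (h : {linear V -> V}) (f : ('I_n -> V) -> W) :
  hom_ext f -> hom_ext (fun x => f (fun m => h (x m))).
Proof.
move=> [mf af f0]; split=> [||n0].
- exact: multilinear_precomp.
- exact: alternating_precomp.
- by apply/funext => x; rewrite f0.
Qed.

Lemma hom_ext_cons_linear n (f : ('I_n -> V) -> W) (y : 'I_n.-1 -> V) :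
  hom_ext f -> linear (fun a => f (cons_args a y)).
Proof.
(* Without arguments the value of [f] does not depend on [a]; it is linear in [a] because the
   convention on Hom(Lambda^0 V, W) makes it 0. *)
case: n f y => [|n] f y [mf af f0] b u v; first by rewrite f0 // scaler0 addr0.
have upd w : cons_args w y = [eta cons_args (n := n.+1) 0 y with ord0 |-> w].
  by apply/funext => m /=; case: (unliftP ord0 m) => [j|] -> /=.
by rewrite (upd (b *: u + v)) (upd u) (upd v) mf.
Qed.

Lemma multilinear_cons n (f : ('I_n -> V) -> W) (a : V) :
  multilinear f -> multilinear (fun y => f (cons_args a y)).
Proof.
case: n f => [|n] f mf; rewrite /multilinear /= => i x b u v; first by case: i.
have upd w : f (cons_args (n := n.+1) a [eta x with i |-> w]) =
    f [eta cons_args (n := n.+1) a x with lift ord0 i |-> w].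
  congr f; apply/funext => m; case: (unliftP ord0 m) => [j|] ->.
    by rewrite /= (inj_eq (@lift_inj _ _)) !liftK.
  by rewrite /= !unlift_none.
by rewrite (etrans (upd _) (mf _ _ b u v)) -!upd.
Qed.

Lemma alternating_cons_tail n (f : ('I_n -> V) -> W) (a : V) :
  alternating f -> alternating (fun y => f (cons_args a y)).
Proof.
case: n f => [|n] f af x i j ij xij; first by case: i ij xij.
apply: (af _ (lift ord0 i) (lift ord0 j)); first by rewrite (inj_eq (@lift_inj _ _)).
by rewrite !cons_args_lift.
Qed.

Lemma hom_ext_altsum k (F : V -> ('I_k.-1 -> V) -> W) :
  (forall r, linear (F^~ r)) -> (forall a, multilinear (F a)) ->
  (forall a, alternating (F a)) -> hom_ext (altsum F).
Proof.
move=> lF mF aF; split.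
- exact: multilinear_altsum.
- exact: alternating_altsum.
- case: k F lF mF aF => // F _ _ _ _.
  by apply/funext => x; rewrite /altsum big_ord0.
Qed.

Lemma hom_ext_altsum2 k (G : V -> V -> ('I_k.-1.-1 -> V) -> W) :
  (forall b r, linear (fun a => G a b r)) ->
  (forall a r, linear (fun b => G a b r)) ->
  (forall a b, multilinear (G a b)) -> (forall a b, alternating (G a b)) ->
  hom_ext (altsum (fun a => altsum (G a))).
Proof.
move=> lG rG mG aG; apply: hom_ext_altsum => [r c u v|a|a].
- rewrite -altsumZ -altsumD; apply: eq_altsum => b {}r; exact: lG.
- exact: multilinear_altsum.
- exact: alternating_altsum.
Qed.

End Exterior.

(** * The coboundary maps as alternating sums *)

Section HomLie.
Variables (K : fieldType) (g : homLieAlgebra K) (M : homLieModule g).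
Hypothesis (charK0 : [pchar K] =i pred0).
Local Notation br := (hl_bracket g).
Local Notation alpha := (hl_twist g).
Local Notation beta := (hm_twist M).
Local Notation act := (hm_act M).

Lemma iter_bracket p x y :
  iter p alpha (br x y) = br (iter p alpha x) (iter p alpha y).
Proof. by elim: p => //= p ->; rewrite hl_mult. Qed.

Lemma iter_linear p : linear (iter p alpha).
Proof. by move=> c u v; elim: p => //= p ->; rewrite linearP. Qed.

(** This is the nested form of [d_alnu], with a free exponent in place of the truncated n - 2; the
    half compensates for counting each pair in both orders. *)
Definition act_pairs q k (f : ('I_k.-1.-1 -> g) -> M) (x : 'I_k -> g) : M :=
  2^-1 *: altsum (fun a => altsum (fun b r =>
    act (br (iter q alpha a) (iter q alpha b)) (f r))) x.

Lemma d_alnuE n (f : ('I_n.-1 -> g) -> M) :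
  d_alnu f = act_pairs (n - 2) (k := n.+1) f.
Proof.
apply/funext => x; apply: (altsum2_skew (k := n.+1)); first exact: (pchar0_neq0 charK0 1).
by move=> a b r; rewrite hl_skew linearNl.
Qed.

Lemma diag_coboundE k p (f : ('I_k.-1 -> g) -> M) x : hom_ext f ->
  diag_cobound p f x
  = altsum (fun a r => act (iter p alpha a) (f r)) x
    - 2^-1 *: altsum (fun a => altsum (fun b r =>
        f (cons_args (br a b) (fun m => alpha (r m))))) x.
Proof.
move=> ef; congr (_ - _); apply: altsum2_skew; first exact: (pchar0_neq0 charK0 1).
move=> a b r; rewrite hl_skew.
exact: (linear_opp _ (hom_ext_cons_linear (fun m => alpha (r m)) ef)).
Qed.

Lemma hom_ext_diag_cobound k p (f : ('I_k.-1 -> g) -> M) :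
  hom_ext f -> hom_ext (diag_cobound p f : ('I_k -> g) -> M).
Proof.
move=> ef; have [mf af _] := ef.
pose F1 a (r : 'I_k.-1 -> g) := act (iter p alpha a) (f r).
pose F2 a b (r : 'I_k.-1.-1 -> g) := f (cons_args (br a b) (fun m => alpha (r m))).
have -> : diag_cobound p f = altsum F1 - 2^-1 *: altsum (fun a => altsum (F2 a)).
  by apply/funext => x; rewrite diag_coboundE.
apply: hom_extB; [|apply: hom_extZ].
  have ea a : hom_ext (fun r => act (iter p alpha a) (f r)).
    exact: hom_ext_postcomp.
  apply: hom_ext_altsum => [r c u v|a|a].
  - by rewrite /F1 iter_linear linearPl.
  - by case: (ea a).
  - by case: (ea a).
have lf r c u v : f (cons_args (c *: u + v) (fun m => alpha (r m)))
    = c *: f (cons_args u (fun m => alpha (r m)))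
      + f (cons_args v (fun m => alpha (r m))).
  exact: (hom_ext_cons_linear (fun m => alpha (r m)) ef).
apply: (@hom_ext_altsum2 _ _ _ _ F2) => [b r c u v|a r c u v|a b|a b].
- by rewrite /F2 linearPl lf.
- by rewrite /F2 linearPr lf.
- exact: (@multilinear_precomp _ _ _ _ alpha _ (@multilinear_cons _ _ _ _ _ (br a b) mf)).
- exact: (@alternating_precomp _ _ _ _ alpha _
    (@alternating_cons_tail _ _ _ _ _ (br a b) af)).
Qed.

Lemma hom_ext_act_pairs q k (f : ('I_k.-1.-1 -> g) -> M) :
  hom_ext f -> hom_ext (act_pairs q f : ('I_k -> g) -> M).
Proof.
move=> ef; apply: hom_extZ.
have ea a : hom_ext (fun r => act a (f r)) by exact: hom_ext_postcomp.
pose F a b (r : 'I_k.-1.-1 -> g) := act (br (iter q alpha a) (iter q alpha b)) (f r).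
apply: (@hom_ext_altsum2 _ _ _ _ F) => [b r c u v|a r c u v|a b|a b].
- by rewrite /F iter_linear !linearPl.
- by rewrite /F iter_linear linearPr linearPl.
- by case: (ea (br (iter q alpha a) (iter q alpha b))).
- by case: (ea (br (iter q alpha a) (iter q alpha b))).
Qed.

Lemma hom_ext_d_nual n (f : ('I_n -> g) -> M) : hom_ext f -> hom_ext (d_nual f).
Proof.
by move=> ef; apply: (hom_extB (hom_ext_postcomp beta ef) (hom_ext_precomp alpha ef)).
Qed.

Lemma cons_bracket_skew n (f : ('I_n -> g) -> M) a b y : hom_ext f ->
  f (cons_args (br a b) y) = - f (cons_args (br b a) y).
Proof.
by move=> ef; rewrite hl_skew (linear_opp _ (hom_ext_cons_linear y ef)).
Qed.

(** The terms record the role of [c]: it acts, another entry acts, it is bracketed with an entry, or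
    two other entries are bracketed. In the third case [c] can be either member of the pair, which
    absorbs the half. *)
Lemma diag_cobound_cons k p (f : ('I_k.-1 -> g) -> M) c y :
  (0 < k)%N -> hom_ext f ->
  diag_cobound p f (cons_args (n := k) c y)
  = act (iter p alpha c) (f y)
    - altsum (fun b r => act (iter p alpha b) (f (cons_args c r))) y
    - altsum (fun b r => f (cons_args (br c b) (fun m => alpha (r m)))) y
    - 2^-1 *: altsum (fun a => altsum (fun b r =>
        f (cons_args (br a b) (cons_args (alpha c) (fun m => alpha (r m)))))) y.
Proof.
case: k f y => // n f y _ ef; rewrite diag_coboundE //.
rewrite (altsum_cons (fun a r => act (iter p alpha a) (f r))).
pose G a b (r : 'I_n.-1 -> g) := f (cons_args (br a b) (fun m => alpha (r m))).
have := @altsum2_cons _ _ _ n G c y _.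
rewrite /= => ->; last by move=> a b r; apply: cons_bracket_skew.
rewrite scalerDr scalerA mulVf ?(pchar0_neq0 charK0 1) // scale1r opprD addrA.
congr (_ - _ *: _); apply: eq_altsum => a r; apply: eq_altsum => b {}r.
by rewrite /G comp_cons_args.
Qed.

(** * Quadratic relations between the component maps *)

Lemma eq_opp0 (v : M) : v = - v -> v = 0.
Proof.
move=> /eqP; rewrite -addr_eq0 -mulr2n -scaler_nat scaler_eq0.
by rewrite (negPf (pchar0_neq0 charK0 1)) => /eqP.
Qed.

(* Exchanging (a, b) with (c, d) is an even permutation of the arguments but
   exchanges the first two arguments of f. *)
Lemma altsum4_bracket_bracket k (f : ('I_k.-1.-1 -> g) -> M) (x : 'I_k -> g) :
  hom_ext f ->
  altsum (fun a => altsum (fun b => altsum (fun c => altsum (fun d r =>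
    f (cons_args (br (alpha c) (alpha d)) (cons_args (alpha (br a b))
      (fun m => alpha (alpha (r m))))))))) x = 0.
Proof.
(* For k < 4 one of the nested sums is empty; otherwise [f] has two slots to exchange. *)
case: k f x => [|[|[|[|k]]]] f x [mf af _].
- exact: big_ord0.
- do 1![apply: altsum_eq0 => ? ?]; exact: big_ord0.
- do 2![apply: altsum_eq0 => ? ?]; exact: big_ord0.
- do 3![apply: altsum_eq0 => ? ?]; exact: big_ord0.
apply: eq_opp0; rewrite [LHS]altsum4_swap -altsumN; apply: eq_altsum => a r.
rewrite -altsumN; apply: eq_altsum => b {}r.
rewrite -altsumN; apply: eq_altsum => c {}r.
rewrite -altsumN; apply: eq_altsum => d {}r.
by rewrite (alternating_cons _ _ _ mf af) !hl_mult.
Qed.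

(** By linearity of [f] in its head entry, the cyclic sum of the summand is [f] at the Hom-Jacobi
    expression. *)
Lemma altsum3_bracket_bracket k (f : ('I_k.-1.-1 -> g) -> M) (x : 'I_k -> g) :
  hom_ext f ->
  altsum (fun a => altsum (fun b => altsum (fun c r =>
    f (cons_args (br (br a b) (alpha c)) (fun m => alpha (alpha (r m))))))) x = 0.
Proof.
move=> ef; apply: altsum3_jacobi => // a b c r.
have lf := hom_ext_cons_linear (fun m => alpha (alpha (r m))) ef.
have fD u v : f (cons_args (u + v) (fun m => alpha (alpha (r m))))
    = f (cons_args u (fun m => alpha (alpha (r m))))
      + f (cons_args v (fun m => alpha (alpha (r m)))).
  by rewrite -[u in LHS]scale1r lf scale1r.
by rewrite -!fD hl_jacobi -[0 in LHS](subrr 0) fD (linear_opp _ lf) subrr.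
Qed.

(** With [p] free this serves the squares of both diagonal maps. The mixed terms [T2], with one
    action and one bracket, cancel; [T1] minus half of [T3] remains, and the module axiom turns the
    antisymmetrised [T1] into brackets acting on [beta (f r)]. *)
Lemma diag_cobound_twice k p (f : ('I_k.-1.-1 -> g) -> M) (x : 'I_k -> g) :
  (1 < k)%N -> hom_ext f ->
  diag_cobound p.+1 (diag_cobound p f) x = act_pairs p (d_nual f) x.
Proof.
move=> k1 ef; have k0 : (0 < k.-1)%N by case: k k1 {f x ef} => [|[]].
rewrite diag_coboundE //; last exact: hom_ext_diag_cobound.
pose T1 := altsum (fun a => altsum (fun b (r : 'I_k.-1.-1 -> g) =>
  act (iter p.+1 alpha a) (act (iter p alpha b) (f r)))) x.
pose F2 a b c (r : 'I_k.-1.-1.-1 -> g) :=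
  act (iter p.+1 alpha a) (f (cons_args (br b c) (fun m => alpha (r m)))).
pose T2 := altsum (fun a => altsum (fun b => altsum (F2 a b))) x.
pose T3 := altsum (fun a => altsum (fun b (r : 'I_k.-1.-1 -> g) =>
  act (br (iter p alpha a) (iter p alpha b)) (f (fun m => alpha (r m))))) x.
have -> : altsum (fun a r => act (iter p.+1 alpha a) (diag_cobound p f r)) x
    = T1 - 2^-1 *: T2.
  rewrite -altsumZ -altsumB; apply: eq_altsum => a r.
  rewrite diag_coboundE // linearBr linearZr /=.
  rewrite !(linear_altsum (act (iter p.+1 alpha a))); congr (_ - _ *: _).
  by apply: eq_altsum => b {}r; rewrite (linear_altsum (act (iter p.+1 alpha a))).
have -> : altsum (fun a => altsum (fun b r => diag_cobound p f
    (cons_args (br a b) (fun m => alpha (r m))))) x = T3 - T2.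
  (* The two zeros stand for the vanishing double-bracket sums, so as to match the four terms of
     [diag_cobound_cons]. *)
  have <- : T3 - T2 - 0 - 2^-1 *: 0 = T3 - T2 by rewrite scaler0 !subr0.
  rewrite -{1}(altsum3_bracket_bracket x ef) -(altsum4_bracket_bracket x ef).
  (* Two rotations make the acting entry of [F2] the innermost variable. *)
  rewrite /T2 (altsum3_cycle F2) (altsum3_cycle (fun a b c => F2 b c a)).
  rewrite -altsumZ -!altsumB; apply: eq_altsum => a r.
  rewrite -altsumZ -!altsumB; apply: eq_altsum => b {}r.
  rewrite diag_cobound_cons // iter_bracket; congr (_ - _ - _ - _).
  by apply: eq_bigr => c _; rewrite /F2 iterSr.
rewrite scalerBr opprB addrA addrNK.
rewrite /T1 (altsum2_half charK0) -scalerBr; congr (_ *: _).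
rewrite -altsumB; apply: eq_altsum => a r; rewrite -altsumB; apply: eq_altsum => b {}r.
by rewrite /= -hm_bracket linearBr.
Qed.

Lemma act_pairs_cons k q (f : ('I_k.-1.-1 -> g) -> M) c y : (0 < k)%N ->
  act_pairs q f (cons_args (n := k) c y)
  = altsum (fun b r => act (br (iter q alpha c) (iter q alpha b)) (f r)) y
    + 2^-1 *: altsum (fun a => altsum (fun b r =>
        act (br (iter q alpha a) (iter q alpha b)) (f (cons_args c r)))) y.
Proof.
case: k f y => // n f y _.
pose G a b (r : 'I_n.-1 -> g) := act (br (iter q alpha a) (iter q alpha b)) (f r).
have := @altsum2_cons _ _ _ n G c y _.
rewrite /act_pairs /= => ->; last by move=> a b r; rewrite /G hl_skew linearNl.
by rewrite scalerDr scalerA mulVf ?(pchar0_neq0 charK0 1) // scale1r.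
Qed.

Lemma bracket_jacobi_r (x y z : g) :
  br (alpha x) (br y z) + br (alpha y) (br z x) + br (alpha z) (br x y) = 0.
Proof.
rewrite (hl_skew _ (br y z)) (hl_skew _ (br z x)) (hl_skew _ (br x y)).
by rewrite -!opprD hl_jacobi oppr0.
Qed.

(** The nested brackets [U2] vanish by Hom-Jacobi, and [U4] matches after exchanging the acting pair
    with the bracketed one. It remains to compare [U1] and [U3], where a single entry acts after,
    respectively before, a pair. *)
Lemma diag_cobound_act_pairs k q (f : ('I_k.-1.-1.-1 -> g) -> M) (x : 'I_k -> g) :
  (1 < k)%N -> hom_ext f ->
  diag_cobound q.+2 (act_pairs q f) x = act_pairs q.+1 (diag_cobound q.+1 f) x.
Proof.
move=> k1 ef; have k0 : (0 < k.-1)%N by case: k k1 {f x ef} => [|[]].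
rewrite diag_coboundE //; last exact: hom_ext_act_pairs.
pose U1 a b c (r : 'I_k.-1.-1.-1 -> g) :=
  act (iter q.+2 alpha a) (act (br (iter q alpha b) (iter q alpha c)) (f r)).
pose U2 a b c (r : 'I_k.-1.-1.-1 -> g) :=
  act (br (iter q alpha (br a b)) (iter q alpha (alpha c))) (f (fun m => alpha (r m))).
pose U3 a b c (r : 'I_k.-1.-1.-1 -> g) :=
  act (br (iter q.+1 alpha a) (iter q.+1 alpha b)) (act (iter q.+1 alpha c) (f r)).
pose U4 a b c d (r : 'I_k.-1.-1.-1.-1 -> g) :=
  act (br (iter q.+1 alpha a) (iter q.+1 alpha b))
    (f (cons_args (br c d) (fun m => alpha (r m)))).
have -> : altsum (fun a r => act (iter q.+2 alpha a) (act_pairs q f r)) x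
    = 2^-1 *: altsum (fun a => altsum (fun b => altsum (U1 a b))) x.
  rewrite -altsumZ; apply: eq_altsum => a r.
  rewrite linearZr /=; congr (_ *: _); rewrite (linear_altsum (act (iter q.+2 alpha a))).
  by apply: eq_altsum => b {}r; rewrite (linear_altsum (act (iter q.+2 alpha a))).
have -> : altsum (fun a => altsum (fun b r => act_pairs q f
    (cons_args (br a b) (fun m => alpha (r m))))) x
    = altsum (fun a => altsum (fun b => altsum (U2 a b))) x
      + 2^-1 *: altsum (fun a => altsum (fun b => altsum (fun c =>
          altsum (U4 a b c)))) x.
  rewrite (altsum4_swap U4) -altsumZ -altsumD; apply: eq_altsum => a r.
  rewrite -altsumZ -altsumD; apply: eq_altsum => b {}r.
  rewrite act_pairs_cons //; congr (_ + _ *: _).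
  apply: eq_bigr => c _; congr (_ *: _); apply: eq_bigr => d _.
  by rewrite /U4 !iterSr.
have -> : altsum (fun a => altsum (fun b => altsum (U2 a b))) x = 0.
  apply: (altsum3_jacobi charK0) => a b c r.
  rewrite /U2 -!linearDl -!iterSr /= !iter_bracket.
  by rewrite hl_jacobi linear0l.
have -> : altsum (fun a => altsum (fun b => altsum (U1 a b))) x
    = altsum (fun a => altsum (fun b => altsum (U3 a b))) x.
  (* By the module axiom [J a b c] equals [U1 a b c - U3 b c a], and its cyclic sum vanishes by
     Hom-Jacobi. *)
  pose J a b c (r : 'I_k.-1.-1.-1 -> g) :=
    act (br (iter q.+1 alpha a) (br (iter q alpha b) (iter q alpha c))) (beta (f r)).
  have J0 : altsum (fun a => altsum (fun b => altsum (J a b))) x = 0.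
    apply: (altsum3_jacobi charK0) => a b c r.
    by rewrite /J -!linearDl bracket_jacobi_r linear0l.
  apply/eqP; rewrite -subr_eq0 (altsum3_cycle U3) -altsumB -[X in _ == X]J0; apply/eqP.
  apply: eq_altsum => a r; rewrite -altsumB; apply: eq_altsum => b {}r.
  rewrite -altsumB; apply: eq_altsum => c {}r.
  by rewrite /J hm_bracket -hl_mult.
rewrite add0r -scalerBr; congr (_ *: _).
rewrite -altsumZ -altsumB; apply: eq_altsum => a r.
rewrite -altsumZ -altsumB; apply: eq_altsum => b {}r.
rewrite diag_coboundE // linearBr linearZr /=.
rewrite !(linear_altsum (act (br _ _))); congr (_ - _ *: _).
by apply: eq_altsum => c {}r; rewrite (linear_altsum (act (br _ _))).
Qed.

(** The identity holds summand by summand: equivariance of [beta] raises the exponent of [alpha] by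
    one, and multiplicativity of [alpha] handles the brackets. *)
Lemma d_nual_diag_cobound k p (f : ('I_k.-1 -> g) -> M) (x : 'I_k -> g) :
  hom_ext f -> d_nual (diag_cobound p f) x = diag_cobound p.+1 (d_nual f) x.
Proof.
move=> ef; rewrite {1}/d_nual !diag_coboundE //; last exact: hom_ext_d_nual.
have subB (A B A' B' : M) : A - B - (A' - B') = A - A' - (B - B').
  by rewrite [in RHS]opprB opprB [B' - A']addrC addrACA [- B + B']addrC.
rewrite linearB linearZ subB -scalerBr.
congr (_ - _ *: _).
  rewrite (linear_altsum beta) altsum_comp -altsumB; apply: eq_altsum => a r.
  by rewrite /d_nual linearBr hm_equiv -iterSr.
rewrite (linear_altsum beta) altsum_comp -altsumB; apply: eq_altsum => a r.
rewrite (linear_altsum beta) altsum_comp -altsumB; apply: eq_altsum => b {}r.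
by rewrite /d_nual comp_cons_args hl_mult.
Qed.

Lemma d_nual_act_pairs k q (f : ('I_k.-1.-1 -> g) -> M) (x : 'I_k -> g) :
  d_nual (act_pairs q f) x = act_pairs q.+1 (d_nual f) x.
Proof.
rewrite /d_nual /act_pairs linearZ -scalerBr; congr (_ *: _).
rewrite (linear_altsum beta) altsum_comp -altsumB; apply: eq_altsum => a r.
rewrite (linear_altsum beta) altsum_comp -altsumB; apply: eq_altsum => b {}r.
by rewrite hm_equiv linearBr -hl_mult -!iterSr.
Qed.

(** * Linearity of the maps and assembly of the complex *)

Lemma linear_diag_cobound k p :
  linear (diag_cobound p : (('I_k.-1 -> g) -> M) -> (('I_k -> g) -> M)).
Proof.
move=> c f h; apply/funext => x; have cfhE y : (c *: f + h) y = c *: f y + h y by [].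
rewrite -[RHS]/(c *: diag_cobound p f x + diag_cobound p h x) /diag_cobound.
rewrite scalerBr addrACA -opprD; congr (_ - _); rewrite scaler_sumr -big_split /=;
  apply: eq_bigr => i _.
  by rewrite cfhE linearPr scalerDr !scalerA mulrC.
rewrite scaler_sumr -big_split /=; apply: eq_bigr => j _.
by rewrite cfhE scalerDr !scalerA mulrC.
Qed.

Lemma linear_d_alnu n :
  linear (@d_alnu K g M n : (('I_n.-1 -> g) -> M) -> (('I_n.+1 -> g) -> M)).
Proof.
move=> c f h; apply/funext => x; have cfhE y : (c *: f + h) y = c *: f y + h y by [].
rewrite -[RHS]/(c *: d_alnu f x + d_alnu h x) /d_alnu.
rewrite scaler_sumr -big_split /=; apply: eq_bigr => i _.
rewrite scaler_sumr -big_split /=; apply: eq_bigr => j _.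
by rewrite cfhE linearPr scalerDr !scalerA mulrC.
Qed.

Lemma linear_d_nual n :
  linear (@d_nual K g M n : (('I_n -> g) -> M) -> (('I_n -> g) -> M)).
Proof.
move=> c f h; apply/funext => x; have cfhE y : (c *: f + h) y = c *: f y + h y by [].
rewrite -[RHS]/(c *: d_nual f x + d_nual h x) /d_nual.
by rewrite !cfhE linearP scalerBr addrACA -opprD.
Qed.

Lemma linear_cobound n : linear (@cobound K g M n).
Proof.
move=> c [f1 f2] [h1 h2]; rewrite /cobound /d_nunu /d_alal /=.
rewrite !linear_diag_cobound linear_d_alnu linear_d_nual.
have linB (U : lmodType K) (a b a' b' : U) :
    c *: a + b - (c *: a' + b') = c *: (a - a') + (b - b').
  by rewrite scalerBr addrACA -opprD.
rewrite [RHS]surjective_pairing; congr (_, _); exact: linB.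
Qed.

Lemma cochain_cobound n (c : precochain M n) :
  cochain c -> cochain (cobound c).
Proof.
case: c => f h [/= ef eh]; split; apply: hom_extB.
- exact: (@hom_ext_diag_cobound n.+1).
- by rewrite d_alnuE //; apply: hom_ext_act_pairs.
- exact: hom_ext_d_nual.
- exact: hom_ext_diag_cobound.
Qed.

(** By linearity the two components split into four differences, which [DD], [DA], [ND] and [NA]
    make zero. *)
Lemma cobound_cobound n (c : precochain M n) :
  cochain c -> cobound (cobound c) = 0.
Proof.
have lin0 (U U' : lmodType K) (F : U -> U') : linear F -> F 0 = 0.
  by move=> lF; rewrite -[0 in LHS](subrr 0) (zmod_morphism_linear lF) subrr.
case: n c => [|n] [f h] [/= ef eh].
  have [_ _ /(_ erefl) f0] := ef; have [_ _ /(_ erefl) h0] := eh.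
  by rewrite f0 h0 -/(0 : precochain M 0) !lin0 //; apply: linear_cobound.
have DD : diag_cobound (k := n.+3) n.+1 (diag_cobound (k := n.+2) n f)
    = d_alnu (n := n.+2) (d_nual f).
  by apply/funext => x; rewrite d_alnuE // !subSS subn0 diag_cobound_twice.
have ND : d_nual (diag_cobound (k := n.+2) n f)
    = diag_cobound (k := n.+2) n.+1 (d_nual f).
  by apply/funext => x; apply: d_nual_diag_cobound.
have DA : diag_cobound (k := n.+3) n.+1 (d_alnu (n := n.+1) h)
    = d_alnu (n := n.+2) (diag_cobound (k := n.+1) n h).
  (* For n = 0, [h] lies in C^1_alpha = 0. This case is separate because the exponent 1 - 2 in
     [d_alnu] is truncated to 0, so the exponents do not fit the general identity. *)
  case: n h eh {f ef DD ND} => [|n] h eh.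
    have [_ _ /(_ erefl) ->] := eh.
    rewrite (lin0 _ _ _ (@linear_d_alnu 1)) (lin0 _ _ _ (@linear_diag_cobound 1 0)).
    by rewrite (lin0 _ _ _ (@linear_diag_cobound 3 1)) (lin0 _ _ _ (@linear_d_alnu 2)).
  by apply/funext => x; rewrite !d_alnuE // !subSS subn0 diag_cobound_act_pairs.
have NA : diag_cobound (k := n.+2) n.+1 (diag_cobound (k := n.+1) n h)
    = d_nual (d_alnu (n := n.+1) h).
  case: n h eh {f ef DD ND DA} => [|n] h eh.
    have [_ _ /(_ erefl) ->] := eh.
    rewrite (lin0 _ _ _ (@linear_d_alnu 1)) (lin0 _ _ _ (@linear_diag_cobound 1 0)).
    by rewrite (lin0 _ _ _ (@linear_diag_cobound 2 1)) (lin0 _ _ _ (@linear_d_nual 2)).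
  apply/funext => x; rewrite d_alnuE // !subSS subn0 d_nual_act_pairs.
  exact: diag_cobound_twice.
have lD k p := zmod_morphism_linear (@linear_diag_cobound k p).
have lA m := zmod_morphism_linear (@linear_d_alnu m).
have lN m := zmod_morphism_linear (@linear_d_nual m).
have comm (U : zmodType) (u v u' v' : U) : u = u' -> v = v' -> u - v - (u' - v') = 0.
  by move=> -> ->; rewrite subrr.
rewrite [LHS]surjective_pairing; congr (_, _).
- apply: etrans (comm _ _ _ _ _ DD DA); congr (_ - _); [exact: lD|exact: lA].
- apply: etrans (comm _ _ _ _ _ ND (esym NA)); congr (_ - _); [exact: lN|exact: lD].
Qed.
End HomLie.

Theorem theorem2p1 (K : fieldType) (charK0 : [pchar K] =i pred0)
    (g : homLieAlgebra K) (M : homLieModule g) :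
  is_cochain_complex (@cochain K g M) (@cobound K g M).
Proof.
split=> [n|n c|n|n c].
- split=> [|a u v [u1 u2] [v1 v2]]; first by split; apply: hom_ext0.
  by split; apply: hom_extP.
- exact: cochain_cobound.
- exact: linear_cobound.
- exact: cobound_cobound.
Qed.
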